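(* Let $\beta(s)$ be a curve in $\mathbb{E}^m$ parametrized by arclength. Then the Laplace image of $\beta$ lies in a line if and only if either (1) $\beta$ is a planar curve whose curvature function $\kappa(s)$ satisfies the differential equation $$\kappa\kappa'' -\kappa^4 =3(\kappa')^2,$$ or (2) $\beta$ is a helix in an affine 3-space whose first and second Frenet curvature functions $\kappa_1$ and $\kappa_2$ satisfy the equations $$\kappa_2 = c\kappa_1 ,\qquad \kappa_1 \kappa_1'' -(1+c^2)\kappa_1^4 =3(\kappa_1')^2,$$ where $c$ is a nonzero constant.
   Context: Curves are smooth and defined on an open interval. For an arclength-parametrized curve the Laplace operator is $\Delta=-\frac{d^2}{ds^2}$, so the Laplace map is $L(s)=-\beta''(s)$; its image is the Laplace image. A line is any affine line of $\mathbb{E}^m$. For a planar curve, $\kappa$ is the (signed) plane curvature. In general the Frenet curvatures are defined by $\beta_1=\beta'$, $\kappa_1=\|\beta_1'\|$, $\beta_1'=\kappa_1\beta_2$ where $\kappa_1\neq0$, $\kappa_2=\|\beta_2'+\kappa_1\beta_1\|$, $\beta_2'=-\kappa_1\beta_1+\kappa_2\beta_3$ where $\kappa_2\ne0$. A helix in an affine 3-space is a curve with $\kappa_1\neq 0$ and $\kappa_2/\kappa_1$ constant. *)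

(* Defs.v *)
From HB Require Import structures.
From mathcomp Require Import all_boot all_order all_algebra.
From mathcomp Require Import all_classical all_reals all_analysis.

Set Implicit Arguments.
Unset Strict Implicit.
Unset Printing Implicit Defensive.

Import Order.TTheory GRing.Theory Num.Theory.
Import numFieldNormedType.Exports.

Local Open Scope ring_scope.
Local Open Scope classical_set_scope.

(* E^m is 'rV[R]_m with the inner product below.  The norm that the library
   puts on 'rV[R]_m is the max norm; it induces the same topology, hence the
   same derivatives, but it must not be used for lengths. *)
Definition dot (R : realType) (m : nat) (u v : 'rV[R]_m) : R :=
  \sum_(i < m) u 0 i * v 0 i.

Definition enorm (R : realType) (m : nat) (u : 'rV[R]_m) : R :=
  Num.sqrt (dot u u).

Definition open_interval (R : realType) (I : set R) : Prop :=
  [/\ I !=set0, open I & is_interval I].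

Definition smooth_on (R : realType) (m : nat) (I : set R)
    (f : R -> 'rV[R]_m) : Prop :=
  forall (n : nat) (s : R), I s -> derivable (derive1n n f) s 1.

Definition arclength_curve (R : realType) (m : nat) (I : set R)
    (beta : R -> 'rV[R]_m) : Prop :=
  smooth_on I beta /\ forall s : R, I s -> enorm (derive1 beta s) = 1.

Definition laplace_map (R : realType) (m : nat) (beta : R -> 'rV[R]_m)
    (s : R) : 'rV[R]_m :=
  - derive1n 2 beta s.

Definition laplace_image (R : realType) (m : nat) (I : set R)
    (beta : R -> 'rV[R]_m) : set 'rV[R]_m :=
  laplace_map beta @` I.

Definition is_line (R : realType) (m : nat) (l : set 'rV[R]_m) : Prop :=
  exists q v : 'rV[R]_m, v != 0 /\ l = [set q + t *: v | t in [set: R]].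

(* The affine subspace through p whose direction is the row space of W. *)
Definition flat (R : realType) (m : nat) (p : 'rV[R]_m) (W : 'M[R]_m) :
    set 'rV[R]_m :=
  [set x | (x - p <= W)%MS].

(* The bilinear form (u, v) |-> dot (u *m J) v is alternating, and on the row
   space of W its square is the squared area of the parallelogram spanned by u
   and v.  For \rank W = 2 it is therefore, on W, the determinant in
   orthonormal coordinates for one of the two orientations of W (and J is,
   followed by the orthogonal projection to W, a rotation by a right angle).
   For \rank W <= 1 it vanishes on W. *)
Definition area_form (R : realType) (m : nat) (W J : 'M[R]_m) : Prop :=
  J^T = - J /\
  forall u v : 'rV[R]_m, (u <= W)%MS -> (v <= W)%MS ->
    dot (u *m J) v ^+ 2 = dot u u * dot v v - dot u v ^+ 2.

(* det (beta', beta''), the signed curvature of an arclength-parametrized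
   curve in a plane oriented by J. *)
Definition plane_curvature (R : realType) (m : nat) (J : 'M[R]_m)
    (beta : R -> 'rV[R]_m) (s : R) : R :=
  dot (derive1 beta s *m J) (derive1n 2 beta s).

(* beta lies in a plane and kappa is its signed curvature for some orientation
   of that plane.  The direction may have dimension less than 2 only so that
   E^1, which contains no plane, is covered; when 2 <= m, any flat of dimension
   at most 2 extends to a plane, with the same curvature up to sign. *)
Definition planar_with_curvature (R : realType) (m : nat) (I : set R)
    (beta : R -> 'rV[R]_m) (kappa : R -> R) : Prop :=
  exists (p : 'rV[R]_m) (W J : 'M[R]_m),
    [/\ (\rank W <= 2)%N, beta @` I `<=` flat p W, area_form W J &
        forall s : R, I s -> kappa s = plane_curvature J beta s].

Definition frenet1 (R : realType) (m : nat) (beta : R -> 'rV[R]_m) :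
    R -> 'rV[R]_m :=
  derive1 beta.

Definition kappa1 (R : realType) (m : nat) (beta : R -> 'rV[R]_m) (s : R) : R :=
  enorm (derive1 (frenet1 beta) s).

Definition frenet2 (R : realType) (m : nat) (beta : R -> 'rV[R]_m) (s : R) :
    'rV[R]_m :=
  (kappa1 beta s)^-1 *: derive1 (frenet1 beta) s.

Definition kappa2 (R : realType) (m : nat) (beta : R -> 'rV[R]_m) (s : R) : R :=
  enorm (derive1 (frenet2 beta) s + kappa1 beta s *: frenet1 beta s).

Definition helix_in_3space (R : realType) (m : nat) (I : set R)
    (beta : R -> 'rV[R]_m) : Prop :=
  [/\ exists (p : 'rV[R]_m) (W : 'M[R]_m),
        \rank W = 3%N /\ beta @` I `<=` flat p W,
      forall s : R, I s -> kappa1 beta s != 0 &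
      exists c : R, forall s : R, I s -> kappa2 beta s / kappa1 beta s = c].

(* Main.v *)
Require Import Defs.
From mathcomp Require Import all_boot all_order all_algebra.
From mathcomp Require Import all_classical all_reals all_analysis.
From mathcomp Require Import ring.

Import Order.TTheory GRing.Theory Num.Theory.
Import numFieldNormedType.Exports.

Local Open Scope ring_scope.
Local Open Scope classical_set_scope.

(* Write [T] for the unit tangent.  If [T' = q + t v] with [v] a unit vector and
   [q] orthogonal to [v], then either [T' = 0] or [T] runs on a circle of radius
   [r] and centre [w] orthogonal to the plane of the circle, whose coordinates
   [(u, f)] satisfy [u' = a] and [u^2 + f^2 = r^2].  Then [kappa1 = a r / f],
   [1 + c^2 = 1 / r^2] with [c = |w| / r], and the equation on the curvature
   says that [1 / kappa1^2] is quadratic in [s] with leading coefficient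
   [- (1 + c^2)].  Conversely, in both cases the equation says exactly that
   [kappa^-3 T''] is constant, so that [T'] moves along a line. *)

Set Implicit Arguments.
Unset Strict Implicit.
Unset Printing Implicit Defensive.

(** The planar equation is singular where [kappa] vanishes: the coefficient of the second derivative
    is [kappa] itself, so uniqueness of solutions does not apply directly, and a signed curvature
    may a priori have isolated zeros. The substitution [kappa ^- 2] settles this: [kappa] is either
    identically zero (a straight line) or nowhere zero. For a helix, [kappa1 != 0] is part of the
    definition. After that both cases are one computation. With [N] the normal and [D = N' / k], the
    frame satisfies [N' = k D] and [D' = - C k N], where [D = - T], [C = 1] in the plane and
    [D = - T + c B], [C = 1 + c^2] for a helix with binormal [B]. Since [T'' = k' N + k^2 D], the
    derivative of [k^-3 T''] is [k^-4 (k k'' - C k^4 - 3 k'^2) N]; this is where the exponent comes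
    from. No binormal is constructed: a frame equation is proved by checking that the difference of
    its two sides, a vector of [W], is orthogonal to a full orthogonal family in [W]. *)

Section EuclideanSpace.
Variables (R : realType) (m : nat).
Implicit Types (u v w : 'rV[R]_m) (a : R).

Lemma dotE u v : dot u v = (u *m v^T) 0 0.
Proof. by rewrite mxE; apply: eq_bigr => i _; rewrite mxE. Qed.

Lemma dotC u v : dot u v = dot v u.
Proof. by apply: eq_bigr => i _; rewrite mulrC. Qed.

Lemma dotDl u v w : dot (u + v) w = dot u w + dot v w.
Proof. by rewrite !dotE mulmxDl mxE. Qed.

Lemma dotDr u v w : dot u (v + w) = dot u v + dot u w.
Proof. by rewrite dotC dotDl !(dotC u). Qed.

Lemma dotZl a u v : dot (a *: u) v = a * dot u v.
Proof. by rewrite !dotE -scalemxAl mxE. Qed.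

Lemma dotZr a u v : dot u (a *: v) = a * dot u v.
Proof. by rewrite dotC dotZl dotC. Qed.

Lemma dotNl u v : dot (- u) v = - dot u v.
Proof. by rewrite -scaleN1r dotZl mulN1r. Qed.

Lemma dotNr u v : dot u (- v) = - dot u v.
Proof. by rewrite dotC dotNl dotC. Qed.

Lemma dot0l v : dot 0 v = 0.
Proof. by rewrite dotE mul0mx mxE. Qed.

Lemma dot0r v : dot v 0 = 0.
Proof. by rewrite dotC dot0l. Qed.

Definition dot_lin := (dotDl, dotDr, dotNl, dotNr, dotZl, dotZr, dot0l, dot0r).

Lemma dot_ge0 u : 0 <= dot u u.
Proof. by apply: sumr_ge0 => i _; rewrite -expr2 sqr_ge0. Qed.

Lemma dot_eq0 u : (dot u u == 0) = (u == 0).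
Proof.
apply/eqP/eqP => [u0|->]; last exact: dot0l.
apply/rowP => i; rewrite mxE; apply/eqP; rewrite -sqrf_eq0 expr2; apply/eqP.
by apply: (psumr_eq0P _ u0) => // j _; rewrite -expr2 sqr_ge0.
Qed.

Lemma dot_gt0 u : u != 0 -> 0 < dot u u.
Proof. by move=> u0; rewrite lt_def dot_eq0 u0 dot_ge0. Qed.

Lemma enorm_sqr u : enorm u ^+ 2 = dot u u.
Proof. by rewrite /enorm sqr_sqrtr// dot_ge0. Qed.

Lemma enorm_eq0 u : (enorm u == 0) = (u == 0).
Proof. by rewrite -sqrf_eq0 enorm_sqr dot_eq0. Qed.

(** The Gram matrix of [s] is diagonal with nonzero diagonal entries, so the members of [s] are
    linearly independent. *)
Lemma orthogonal_leq_rank (W : 'M[R]_m) (s : seq 'rV[R]_m) :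
  all (fun u => (u != 0) && (u <= W)%MS) s ->
  pairwise (fun u v => dot u v == 0) s -> (size s <= \rank W)%N.
Proof.
move=> /allP sW /(pairwiseP 0) orth.
pose M := \matrix_(i < size s) nth 0 s i.
have Mrow i : row i M = nth 0 s i by rewrite rowK.
have MMT i j : i != j -> (M *m M^T) i j = 0.
  move=> ij; have -> : (M *m M^T) i j = dot (row i M) (row j M).
    by rewrite dotE tr_row !mxE; apply: eq_bigr => k _; rewrite !mxE.
  rewrite !Mrow; have [lij|lji|/ord_inj eij] := ltngtP i j.
  - by apply/eqP/orth; rewrite ?inE.
  - by rewrite dotC; apply/eqP/orth; rewrite ?inE.
  - by rewrite eij eqxx in ij.
have MMT1 i : (M *m M^T) i i != 0.
  have -> : (M *m M^T) i i = dot (row i M) (row i M).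
    by rewrite dotE tr_row !mxE; apply: eq_bigr => k _; rewrite !mxE.
  rewrite Mrow dot_eq0; have := sW (nth 0 s i).
  by rewrite mem_nth// => /(_ isT) /andP[].
have Mfree : row_free M.
  apply: inj_row_free => v vM0.
  apply/rowP => j; rewrite mxE; apply/eqP; move: (MMT1 j); apply: contraNT.
  have : (v *m (M *m M^T)) 0 j = 0 by rewrite mulmxA vM0 mul0mx mxE.
  rewrite mxE (bigD1 j)//= big1 ?addr0 => [/eqP|k kj]; last first.
    by rewrite MMT ?mulr0.
  by rewrite mulf_eq0 => /orP[->|->].
rewrite -(eqP Mfree); apply/mxrankS/row_subP => i; rewrite Mrow.
by have := sW (nth 0 s i); rewrite mem_nth// => /(_ isT) /andP[].
Qed.

(** A nonzero [u] could be added to [s], giving more independent vectors in [W] than its rank. The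
    frame equations below are derived from this. *)
Lemma orthogonal_complement_eq0 (W : 'M[R]_m) (s : seq 'rV[R]_m) u :
  (\rank W <= size s)%N -> all (fun v => (v != 0) && (v <= W)%MS) s ->
  pairwise (fun v w => dot v w == 0) s ->
  (u <= W)%MS -> all (fun v => dot u v == 0) s -> u = 0.
Proof.
move=> rW sW sO uW us; apply/eqP/negPn/negP => u0.
have := @orthogonal_leq_rank W (u :: s).
by rewrite /= u0 uW us sW sO => /(_ isT isT); rewrite leqNgt ltnS rW.
Qed.

End EuclideanSpace.

(** * Differentiation rules, and constancy on an interval from a zero derivative *)

Section Calculus.
Variable R : realType.
Implicit Types (x : R) (I : set R) (k : R -> R).

Lemma is_derive1E (V : normedModType R) (f : R -> V) x df :
  is_derive x 1 f df -> derive1 f x = df.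
Proof. by rewrite derive1E => ?; rewrite derive_val. Qed.

Lemma is_derive1P (V : normedModType R) (f : R -> V) x :
  derivable f x 1 -> is_derive x 1 f (derive1 f x).
Proof. by rewrite derive1E; exact: derivableP. Qed.

(* Pointwise forms: the library lemmas are about operations of the ring of
   functions, which [apply] does not find in a lambda-abstraction. *)
Lemma is_deriveDf (V : normedModType R) (f g : R -> V) x df dg :
  is_derive x 1 f df -> is_derive x 1 g dg ->
  is_derive x 1 (fun t => f t + g t) (df + dg).
Proof. exact: is_deriveD. Qed.

Lemma is_deriveNf (V : normedModType R) (f : R -> V) x df :
  is_derive x 1 f df -> is_derive x 1 (fun t => - f t) (- df).
Proof. exact: is_deriveN. Qed.

Lemma is_deriveBf (V : normedModType R) (f g : R -> V) x df dg :
  is_derive x 1 f df -> is_derive x 1 g dg ->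
  is_derive x 1 (fun t => f t - g t) (df - dg).
Proof. exact: is_deriveB. Qed.

Lemma is_deriveVf k x (dk : R) : k x != 0 -> is_derive x 1 k dk ->
  is_derive x 1 (fun t => (k t)^-1) (- dk / k x ^+ 2).
Proof.
move=> k0 dkx; apply: DeriveDef; first exact: derivableV.
by rewrite deriveV// derive_val /GRing.scale/=; field.
Qed.

Lemma is_deriveMf k k' x (dk dk' : R) :
  is_derive x 1 k dk -> is_derive x 1 k' dk' ->
  is_derive x 1 (fun t => k t * k' t) (dk * k' x + k x * dk').
Proof.
move=> h h'; apply: (is_derive_eq (is_deriveM h h')).
by rewrite /GRing.scale/= addrC mulrC.
Qed.

Lemma is_deriveXf k n x (dk : R) : is_derive x 1 k dk ->
  is_derive x 1 (fun t => k t ^+ n) (n%:R * k x ^+ n.-1 * dk).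
Proof.
move=> h; have -> : (fun t => k t ^+ n) = k ^+ n.
  by apply/funext => t; elim: n => [|n IH]; rewrite ?expr0// !exprS IH.
exact: is_deriveX.
Qed.

Lemma is_derive_sqrtf k x (dk : R) : 0 < k x -> is_derive x 1 k dk ->
  is_derive x 1 (fun t => Num.sqrt (k t)) (dk / (2 * Num.sqrt (k x))).
Proof.
move=> k0 h; have h' := is_derive1_sqrt k0.
by apply: (is_derive_eq (is_derive1_comp h' h)); rewrite /= mulrC.
Qed.

Lemma is_derive_mxP (p q : nat) (F : R -> 'M[R]_(p, q)) x dF :
  is_derive x 1 F dF <->
  forall i j, is_derive x 1 (fun t => F t i j) (dF i j).
Proof.
split=> [h i j|h].
  have Fx : derivable F x 1 by [].
  apply: DeriveDef; first exact: ((derivable_mxP F x 1).1 Fx).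
  by rewrite -(@derive_val _ _ _ _ _ _ _ h) derive_mx// mxE.
have Fx : derivable F x 1.
  by apply: (derivable_mxP F x 1).2 => i j; have := h i j.
apply: DeriveDef => //; apply/matrixP => i j.
by rewrite derive_mx// mxE derive_val.
Qed.

Lemma is_derive_sumf n (h : 'I_n -> R -> R) x (dh : 'I_n -> R) :
  (forall i, is_derive x 1 (h i) (dh i)) ->
  is_derive x 1 (fun t => \sum_(i < n) h i t) (\sum_(i < n) dh i).
Proof. by move=> /is_derive_sum; rewrite fct_sumE. Qed.

Variable m : nat.
Implicit Types F G : R -> 'rV[R]_m.

Lemma is_derive_dot F G x dF dG :
  is_derive x 1 F dF -> is_derive x 1 G dG ->
  is_derive x 1 (fun t => dot (F t) (G t)) (dot dF (G x) + dot (F x) dG).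
Proof.
move=> /is_derive_mxP h /is_derive_mxP h'; rewrite /dot -big_split/=.
by apply: is_derive_sumf => i; exact: is_deriveMf.
Qed.

Lemma is_derive_dotl F x dF v : is_derive x 1 F dF ->
  is_derive x 1 (fun t => dot (F t) v) (dot dF v).
Proof.
move=> h; apply: (is_derive_eq (is_derive_dot h (is_derive_cst v x 1))).
by rewrite dot0r addr0.
Qed.

Lemma is_derive_scale k F x (dk : R) dF :
  is_derive x 1 k dk -> is_derive x 1 F dF ->
  is_derive x 1 (fun t => k t *: F t) (dk *: F x + k x *: dF).
Proof.
move=> h /is_derive_mxP h'; apply/is_derive_mxP => i j; rewrite !mxE.
by under eq_fun do rewrite mxE; exact: is_deriveMf.
Qed.

Lemma is_derive_mulmx n (A : 'M[R]_(m, n)) F x dF :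
  is_derive x 1 F dF -> is_derive x 1 (fun t => F t *m A) (dF *m A).
Proof.
move=> /is_derive_mxP h; apply/is_derive_mxP => i j; rewrite mxE.
under eq_fun do rewrite mxE; apply: is_derive_sumf => l.
apply: (is_derive_eq (is_deriveMf (h i l) (is_derive_cst (A l j) x 1))).
by rewrite mulr0 addr0.
Qed.

Lemma derive0_cst_on I k : is_interval I ->
  (forall s, I s -> is_derive s 1 k 0) -> forall s t, I s -> I t -> k s = k t.
Proof.
move=> Iitv dk; suff H s t : I s -> I t -> s <= t -> k s = k t.
  by move=> s t Is It; have [/H->|/ltW/H->] := leP s t.
move=> Is It st.
have Ist c : c \in `[s, t]%R -> I c by rewrite in_itv/= => /(Iitv _ _ Is It).
have [|||c _] := @MVT_segment _ k (cst 0) s t => //.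
- by move=> c cst_; apply/dk/Ist/subset_itv_oo_cc.
- apply: derivable_within_continuous => c /Ist /dk h; exact: ex_derive.
- by rewrite mul0r => /eqP; rewrite subr_eq0 => /eqP.
Qed.

Lemma derive0_cst_on_mx (p q : nat) I (F : R -> 'M[R]_(p, q)) : is_interval I ->
  (forall s, I s -> is_derive s 1 F 0) -> forall s t, I s -> I t -> F s = F t.
Proof.
move=> Iitv dF s t Is It; apply/matrixP => i j.
apply: (@derive0_cst_on I (fun t => F t i j)) => // r /dF /is_derive_mxP.
by move=> /(_ i j); rewrite mxE.
Qed.

(** A derivative depends only on the germ, and an open [I] is a neighbourhood of each of its points;
    identities that hold only on [I] can therefore be differentiated there. *)
Lemma is_derive_on (V : normedModType R) I (f g : R -> V) s df : open I ->
  I s -> (forall t, I t -> f t = g t) -> is_derive s 1 f df ->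
  is_derive s 1 g df.
Proof.
move=> oI Is fg; apply: near_eq_is_derive.
by near=> t; apply: fg; near: t; exact: open_nbhs_nbhs.
Unshelve. all: by end_near. Qed.

Lemma derive1_on (V : normedModType R) I (f g : R -> V) s : open I ->
  I s -> (forall t, I t -> f t = g t) -> derive1 f s = derive1 g s.
Proof.
move=> oI Is fg; rewrite !derive1E; apply: near_eq_derive.
by near=> t; apply: fg; near: t; exact: open_nbhs_nbhs.
Unshelve. all: by end_near. Qed.

End Calculus.

(** * The equation [k k'' - C k^4 = 3 k'^2] *)

Section CurvatureEquation.
Variable R : realType.
Implicit Types (I : set R) (k : R -> R).

(* [k ^- 2] has second derivative [-2] where [k] does not vanish, so it is a
   polynomial there and cannot blow up at a first zero of [k]. *)
Lemma curvature_ode_neq0_right I k k1 k2 : is_interval I ->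
  (forall s, I s -> is_derive s 1 k (k1 s)) ->
  (forall s, I s -> is_derive s 1 k1 (k2 s)) ->
  (forall s, I s -> k s * k2 s - k s ^+ 4 = 3 * k1 s ^+ 2) ->
  forall s t, I s -> I t -> s <= t -> k s != 0 -> k t != 0.
Proof.
move=> Iitv dk dk1 ode s t Is It st ks0; apply/negP => /eqP kt0.
have Ist x : s <= x <= t -> I x by exact: Iitv.
have ck x : I x -> {for x, continuous k}.
  move=> /dk dkx; apply/differentiable_continuous/derivable1_diffP.
  exact: ex_derive.
pose Z := [set x | s <= x <= t /\ k x = 0].
have Zt : Z t by split=> //; rewrite st lexx.
have Zinf : has_inf Z by split; [exists t | exists s => x [/andP[]]].
pose z := inf Z.
have sz : s <= z by apply: lb_le_inf; [exists t | move=> x [/andP[]]].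
have zZ x : Z x -> z <= x by move=> Zx; apply: ge_inf => //; case: Zinf.
have Iz : I z by apply: Ist; rewrite sz zZ.
have kz0 : k z = 0.
  apply/eqP/negPn/negP => kz0.
  have /nbhs_ballP[e e0 ke] : \forall x \near z, k x != 0.
    by apply: (cvgr_neq0 (F := nbhs z)) kz0; exact: ck.
  have [x Zx xz] := inf_adherent e0 Zinf.
  suff /ke : ball z e x by case: Zx => _ /= ->; rewrite eqxx.
  by rewrite /ball/= distrC ger0_norm ?subr_ge0 ?zZ// ltrBlDl.
have ltsz : s < z.
  by rewrite lt_neqAle sz andbT; apply: contraNneq ks0 => ->; rewrite kz0.
pose A := `[s, z[%classic : set R.
have Ax x : A x -> I x /\ k x != 0.
  rewrite /A/= in_itv/= => /andP[sx xz]; split.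
    by apply: (Iitv s z) => //; rewrite sx ltW.
  apply/negP => /eqP kx; suff /zZ : Z x by rewrite leNgt xz.
  by split=> //; rewrite sx (le_trans (ltW xz))// zZ.
have Aitv : is_interval A by exact: interval_is_interval.
have As : A s by rewrite /A/= in_itv/= lexx.
(* Left of the first zero [z] the equation reads [(k^-2)'' = -2]. Hence [(k^-2)' + 2 x] is a
   constant [b], and then [k^-2 + x^2 - b x] is a constant [c]. *)
pose b := -2 * (k1 s * (k s)^-1 ^+ 3) + 2 * s.
have bE x : A x -> -2 * (k1 x * (k x)^-1 ^+ 3) + 2 * x = b.
  move=> xA; apply: (@derive0_cst_on _ A
    (fun x => -2 * (k1 x * (k x)^-1 ^+ 3) + 2 * x)) => //.
  move=> y /Ax[Iy ky0]; apply: is_derive_eq.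
    apply: is_deriveDf; apply: is_deriveMf.
    apply: is_deriveMf; first exact: dk1.
    by apply: is_deriveXf; apply: is_deriveVf => //; exact: dk.
  have -> : k2 y = (3 * k1 y ^+ 2 + k y ^+ 4) / k y.
    by rewrite -ode// subrK mulrAC mulfV// mul1r.
  by rewrite /GRing.scale/=; field.
pose c := (k s)^-1 ^+ 2 + s ^+ 2 - b * s.
have cE x : A x -> (k x)^-1 ^+ 2 + x ^+ 2 - b * x = c.
  move=> xA; apply: (@derive0_cst_on _ A
    (fun x => (k x)^-1 ^+ 2 + x ^+ 2 - b * x)) => //.
  move=> y Ay; have [Iy ky0] := Ax _ Ay; apply: is_derive_eq.
    apply: is_deriveBf.
    apply: is_deriveDf.
    by apply: is_deriveXf; apply: is_deriveVf => //; exact: dk.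
  by rewrite -(bE y Ay) /GRing.scale/=; field.
(* Clearing the denominator gives a function that is continuous at [z], equal to [1] on [[s, z[] and
   equal to [0] at [z], which is the contradiction. *)
pose psi x := k x ^+ 2 * (c + b * x - x ^+ 2).
have psi1 x : A x -> psi x = 1.
  by move=> xA; have [_ kx0] := Ax _ xA; rewrite /psi -(cE x xA); field.
have psiz : is_derive z 1 psi (2%:R * k z ^+ 1 * k1 z * (c + b * z - z ^+ 2) +
     k z ^+ 2 * (0 + (0 * z + b * 1) - 2%:R * z ^+ 1 * 1)).
  apply: is_deriveMf; first by apply: is_deriveXf; exact: dk.
  apply: is_deriveBf; last by apply: is_deriveXf.
  by apply: is_deriveDf; apply: is_deriveMf.
have /nbhs_ballP[e e0 psie] : \forall x \near z, psi x < 1.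
  have cpsi : psi x @[x --> z] --> psi z.
    by apply/differentiable_continuous/derivable1_diffP; exact: ex_derive.
  by apply: (cvgr_lt _ cpsi); rewrite /psi kz0 expr0n mul0r.
pose x := Num.max s (z - e / 2).
have xz : x < z by rewrite gt_max ltsz/= ltrBlDl ltrDr divr_gt0.
have : A x by rewrite /A/= in_itv/= xz le_max lexx.
move=> /psi1 psix; suff /psie : ball z e x by rewrite /= psix ltxx.
rewrite /ball/= ger0_norm ?subr_ge0 ?ltW//.
rewrite ltrBlDl -ltrBlDr lt_max; apply/orP; right.
by rewrite ltrD2l ltrN2 ltr_pdivrMr// ltr_pMr// ltr1n.
Qed.

(** The equation is invariant under [s |-> - s], because the first derivative enters only squared;
    this turns propagation to the right into propagation to the left. *)
Lemma curvature_ode_neq0 I k k1 k2 : is_interval I ->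
  (forall s, I s -> is_derive s 1 k (k1 s)) ->
  (forall s, I s -> is_derive s 1 k1 (k2 s)) ->
  (forall s, I s -> k s * k2 s - k s ^+ 4 = 3 * k1 s ^+ 2) ->
  forall s t, I s -> I t -> k s != 0 -> k t != 0.
Proof.
move=> Iitv dk dk1 ode s t Is It; have [st|/ltW ts] := leP s t.
  exact: curvature_ode_neq0_right st.
have dN (x : R) : is_derive x 1 (-%R : R -> R) (-1) by exact: is_deriveNid.
have := @curvature_ode_neq0_right [set x | I (- x)] (k \o -%R)
  (fun x => - k1 (- x)) (k2 \o -%R) _ _ _ _ (- s) (- t).
rewrite /= !opprK lerN2; apply => //.
- move=> x y Ix Iy r /andP[xr ry]; apply: (Iitv (- y) (- x)) => //.
  by rewrite !lerN2 ry.
- move=> x Ix; apply: (is_derive_eq (is_derive1_comp (dk _ Ix) (dN x))).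
  by rewrite mulrN1.
- move=> x Ix; have h := is_derive1_comp (dk1 _ Ix) (dN x).
  by apply: (is_derive_eq (is_deriveNf h)); rewrite mulrN1 opprK.
- by move=> x Ix; rewrite sqrrN; exact: ode.
Qed.

Variable m : nat.

(* The direction of the line is the constant vector [k ^- 3 *: T''], where
   [T' = k *: N]. *)
Lemma curvature_ode_image_line I (N D : R -> 'rV[R]_m) k k1 k2 (C : R) :
  I !=set0 -> is_interval I ->
  (forall s, I s -> k s != 0) ->
  (forall s, I s -> is_derive s 1 N (k s *: D s)) ->
  (forall s, I s -> is_derive s 1 D (- (C * k s) *: N s)) ->
  (forall s, I s -> is_derive s 1 k (k1 s)) ->
  (forall s, I s -> is_derive s 1 k1 (k2 s)) ->
  (forall s, I s -> k s * k2 s - C * k s ^+ 4 = 3 * k1 s ^+ 2) ->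
  exists q v : 'rV[R]_m, forall s, I s -> exists t, k s *: N s = q + t *: v.
Proof.
move=> [s0 Is0] Iitv k0 dN dD dk dk1 ode.
pose V s := (k1 s * (k s)^-1 ^+ 3) *: N s + (k s)^-1 *: D s.
have VE s : I s -> V s = V s0.
  move=> Is; apply: (derive0_cst_on_mx Iitv) => // x Ix.
  have kx0 := k0 x Ix; apply: is_derive_eq.
    apply: is_deriveDf; apply: is_derive_scale.
    - apply: is_deriveMf; first exact: dk1.
      by apply: is_deriveXf; apply: is_deriveVf => //; exact: dk.
    - exact: dN.
    - by apply: is_deriveVf => //; exact: dk.
    - exact: dD.
  have -> : k2 x = (3 * k1 x ^+ 2 + C * k x ^+ 4) / k x.
    by rewrite -ode// subrK mulrAC mulfV// mul1r.
  by apply/rowP => i; rewrite !mxE; field.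
set v := V s0 in VE.
have dT' s : I s -> is_derive s 1 (fun t => k t *: N t) (k s ^+ 3 *: v).
  move=> Is; have ks0 := k0 s Is; apply: is_derive_eq.
    by apply: is_derive_scale; [exact: dk | exact: dN].
  by rewrite -(VE s Is); apply/rowP => i; rewrite !mxE; field.
(* The coordinate of [T'] along [v]. If [v = 0] the quotient is [0] by convention, which is
   harmless: [T'] is then constant, its derivative being [k^3 v]. *)
pose t s := dot (k s *: N s) v / dot v v.
exists (k s0 *: N s0 - t s0 *: v), v => s Is; exists (t s).
apply/eqP; rewrite -subr_eq; apply/eqP.
apply: (derive0_cst_on_mx (F := fun s => k s *: N s - t s *: v) Iitv) => //.
move=> x Ix.
apply: is_derive_eq.
  apply: is_deriveBf; first exact: dT'.
  apply: is_derive_scale => //; rewrite /t; apply: is_deriveMf => //.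
  by apply: is_derive_dotl; exact: dT'.
rewrite scaler0 mulr0 !addr0 dotZl.
have [->|v0] := eqVneq v 0; first by rewrite !scaler0 subrr.
by rewrite mulfK ?subrr// dot_eq0.
Qed.

End CurvatureEquation.

(** * Moving frames in dimensions two and three: from the curvature equation to a line *)

Section UnitTangentField.
Variables (R : realType) (m : nat) (I : set R).
Hypothesis hI : open_interval I.

Let I0 : I !=set0. Proof. by case: hI. Qed.
Let oI : open I. Proof. by case: hI. Qed.
Let Iitv : is_interval I. Proof. by case: hI. Qed.

(** Membership in the row space of [W] is the linear equation [F s *m cokermx W = 0], which can be
    differentiated. *)
Lemma is_derive_submx (W : 'M[R]_m) (F F' : R -> 'rV[R]_m) :
  (forall s, I s -> is_derive s 1 F (F' s)) ->
  (forall s, I s -> (F s <= W)%MS) -> forall s, I s -> (F' s <= W)%MS.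
Proof.
move=> dF FW s Is.
have h := is_derive_mulmx (cokermx W) (dF s Is).
have h0 : is_derive s 1 (fun t => F t *m cokermx W) 0.
  apply: (is_derive_on (f := cst 0) oI Is) (is_derive_cst _ _ _) => t It.
  by apply/esym/eqP; rewrite -submxE FW.
by rewrite submxE -(is_derive1E h) (is_derive1E h0).
Qed.

Lemma is_derive_flat p (W : 'M[R]_m) (F F' : R -> 'rV[R]_m) :
  (forall s, I s -> is_derive s 1 F (F' s)) -> F @` I `<=` flat p W ->
  forall s, I s -> (F' s <= W)%MS.
Proof.
move=> dF FW; apply: (is_derive_submx (F := fun t => F t - p)) => s Is.
  apply: (is_derive_eq (is_deriveBf (dF s Is) (is_derive_cst p s 1))).
  by rewrite subr0.
by apply: FW; exists s.
Qed.

Lemma dot_cst_derive (F G : R -> 'rV[R]_m) s dF dG (c : R) : I s ->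
  (forall t, I t -> dot (F t) (G t) = c) ->
  is_derive s 1 F dF -> is_derive s 1 G dG ->
  dot dF (G s) + dot (F s) dG = 0.
Proof.
move=> Is FG hF hG; have h := is_derive_dot hF hG.
have h0 : is_derive s 1 (fun t => dot (F t) (G t)) 0.
  by apply: (is_derive_on (f := cst c) oI Is) => t It; rewrite FG.
by rewrite -(is_derive1E h) (is_derive1E h0).
Qed.

Lemma derive1n2_on (f g g1 g2 : R -> R) :
  (forall s, I s -> f s = g s) -> (forall s, I s -> is_derive s 1 g (g1 s)) ->
  (forall s, I s -> is_derive s 1 g1 (g2 s)) ->
  forall s, I s -> derive1 f s = g1 s /\ derive1n 2 f s = g2 s.
Proof.
move=> fg dg dg1.
have df s : I s -> derive1 f s = g1 s.
  by move=> Is; rewrite (derive1_on oI Is fg); exact: is_derive1E (dg s Is).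
move=> s Is; split; first exact: df.
rewrite derive1nS derive1n1 (derive1_on oI Is df).
exact: is_derive1E (dg1 s Is).
Qed.

Variables T T' T'' : R -> 'rV[R]_m.
Hypothesis dT : forall s, I s -> is_derive s 1 T (T' s).
Hypothesis dT' : forall s, I s -> is_derive s 1 T' (T'' s).
Hypothesis dotTT : forall s, I s -> dot (T s) (T s) = 1.

Lemma T_neq0 s : I s -> T s != 0.
Proof. by move=> Is; rewrite -dot_eq0 dotTT// oner_eq0. Qed.

Lemma dotTT' s : I s -> dot (T s) (T' s) = 0.
Proof.
move=> Is; have := dot_cst_derive Is dotTT (dT Is) (dT Is).
by rewrite dotC -mulr2n => /eqP; rewrite mulrn_eq0/= => /eqP.
Qed.

Lemma planar_unit_tangent (W : 'M[R]_m) (k k1 k2 : R -> R) :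
  (\rank W <= 2)%N -> (forall s, I s -> (T s <= W)%MS) ->
  (forall s, I s -> k s ^+ 2 = dot (T' s) (T' s)) ->
  (forall s, I s -> is_derive s 1 k (k1 s)) ->
  (forall s, I s -> is_derive s 1 k1 (k2 s)) ->
  (forall s, I s -> k s * k2 s - k s ^+ 4 = 3 * k1 s ^+ 2) ->
  exists q v : 'rV[R]_m, forall s, I s -> exists t, T' s = q + t *: v.
Proof.
move=> rW TW k2E dk dk1 ode.
have T'W s : I s -> (T' s <= W)%MS.
  exact: is_derive_submx dT TW s.
have T''W s : I s -> (T'' s <= W)%MS.
  exact: is_derive_submx dT' T'W s.
(* If [k] is identically zero then [T' = 0]. Otherwise one nonzero value excludes zeros on all of
   [I], and dividing [T'] by the signed [k] gives a differentiable unit normal. *)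
have [k0|/existsNP[s0 /not_implyP[Is0 /eqP ks0]]] :=
    pselect (forall s, I s -> k s = 0).
  exists 0, 0 => s Is; exists 0; rewrite scaler0 addr0.
  by apply/eqP; rewrite -dot_eq0 -k2E// k0// expr0n.
have k0 s : I s -> k s != 0.
  move=> Is; exact: (curvature_ode_neq0 Iitv dk dk1 ode Is0 Is).
pose N s := (k s)^-1 *: T' s.
have T'E s : I s -> T' s = k s *: N s.
  by move=> Is; rewrite scalerA divff ?k0// scale1r.
pose N' s := (- k1 s / k s ^+ 2) *: T' s
              + (k s)^-1 *: T'' s.
have dN s : I s -> is_derive s 1 N (N' s).
  move=> Is; apply: is_derive_scale; last exact: dT'.
  by apply: is_deriveVf; [exact: k0 | exact: dk].
have dotTN s : I s -> dot (T s) (N s) = 0.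
  by move=> Is; rewrite dotZr dotTT'// mulr0.
have dotNN s : I s -> dot (N s) (N s) = 1.
  by move=> Is; have := k0 s Is; rewrite dotZl dotZr -k2E// => ?; field.
have NW s : I s -> (N s <= W)%MS by move=> Is; rewrite scalemx_sub ?T'W.
have N'W s : I s -> (N' s <= W)%MS.
  by move=> Is; rewrite addmx_sub ?scalemx_sub ?T'W ?T''W.
clearbody N N'.
(* Differentiating [dot N N = 1] and [dot T N = 0] shows that [N' + k T] is orthogonal to [N] and to
   [T], which fill [W]. *)
have N'E s : I s -> N' s = k s *: (- T s).
  move=> Is; apply/eqP; rewrite scalerN -addr_eq0; apply/eqP.
  apply: (orthogonal_complement_eq0 (W := W) (s := [:: T s; N s])) => //=.
  - rewrite T_neq0// TW// NW// andbT/= -dot_eq0 dotNN//.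
    by rewrite oner_neq0.
  - by rewrite dotTN// eqxx.
  - by rewrite addmx_sub ?N'W ?scalemx_sub ?TW.
  - have := dot_cst_derive Is dotTN (dT Is) (dN s Is).
    have := dot_cst_derive Is dotNN (dN s Is) (dN s Is).
    rewrite (dotC (N s) (N' s)) -mulr2n => /eqP; rewrite mulrn_eq0/= => /eqP NN.
    rewrite {1}T'E// dotZl dotNN// mulr1 dotC => TN.
    rewrite !dot_lin dotTT// dotTN// NN mulr0 addr0 eqxx andbT mulr1.
    by rewrite addrC TN eqxx.
have dN' s : I s -> is_derive s 1 N (k s *: (- T s)).
  by move=> Is; rewrite -N'E//; exact: dN.
have dNT s : I s -> is_derive s 1 (fun t => - T t) (- (1 * k s) *: N s).
  by move=> Is; rewrite mul1r scaleNr -T'E//; apply: is_deriveNf; exact: dT.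
have ode1 s : I s -> k s * k2 s - 1 * k s ^+ 4 = 3 * k1 s ^+ 2.
  by move=> Is; rewrite mul1r ode.
have [q [v qv]] := curvature_ode_image_line I0 Iitv k0 dN' dNT dk dk1 ode1.
by exists q, v => s Is; rewrite T'E//; exact: qv.
Qed.

Lemma helix_unit_tangent (W : 'M[R]_m) (k k1 k2 : R -> R) (N N' : R -> 'rV[R]_m)
    (c : R) : c != 0 ->
  \rank W = 3%N -> (forall s, I s -> (T s <= W)%MS) ->
  (forall s, I s -> k s != 0) ->
  (forall s, I s -> k s ^+ 2 = dot (T' s) (T' s)) ->
  (forall s, I s -> is_derive s 1 k (k1 s)) ->
  (forall s, I s -> is_derive s 1 k1 (k2 s)) ->
  (forall s, I s -> T' s = k s *: N s) ->
  (forall s, I s -> is_derive s 1 N (N' s)) ->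
  (forall s, I s -> derivable N' s 1) ->
  (forall s, I s ->
    dot (N' s + k s *: T s) (N' s + k s *: T s) = (c * k s) ^+ 2) ->
  (forall s, I s -> k s * k2 s - (1 + c ^+ 2) * k s ^+ 4 = 3 * k1 s ^+ 2) ->
  exists q v : 'rV[R]_m, forall s, I s -> exists t, T' s = q + t *: v.
Proof.
move=> c0 rW TW k0 k2E dk dk1 T'E dN N'd kappa2E ode.
have T'W s : I s -> (T' s <= W)%MS.
  exact: is_derive_submx dT TW s.
have dotTN s : I s -> dot (T s) (N s) = 0.
  move=> Is; have := dotTT' Is; rewrite T'E// dotZr => /eqP.
  by rewrite mulf_eq0 (negPf (k0 s Is)) => /eqP.
have dotNN s : I s -> dot (N s) (N s) = 1.
  move=> Is; have := k2E s Is; rewrite T'E// dotZl dotZr mulrA -expr2.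
  by rewrite -[LHS]mulr1 => /(mulfI (expf_neq0 2 (k0 s Is))).
have NW s : I s -> (N s <= W)%MS.
  move=> Is; have -> : N s = (k s)^-1 *: T' s.
    by rewrite T'E// scalerA mulVf ?k0// scale1r.
  by rewrite scalemx_sub ?T'W.
have N'W s : I s -> (N' s <= W)%MS.
  exact: is_derive_submx dN NW s.
have dotN'N s : I s -> dot (N' s) (N s) = 0.
  move=> Is; have := dot_cst_derive Is dotNN (dN s Is) (dN s Is).
  by rewrite (dotC (N s)) -mulr2n => /eqP; rewrite mulrn_eq0/= => /eqP.
have dotTN' s : I s -> dot (T s) (N' s) = - k s.
  move=> Is; have := dot_cst_derive Is dotTN (dT Is) (dN s Is).
  by rewrite T'E// dotZl dotNN// mulr1 addrC => /eqP; rewrite addr_eq0 => /eqP.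
have dotN'N' s : I s -> dot (N' s) (N' s) = (1 + c ^+ 2) * k s ^+ 2.
  move=> Is; have := kappa2E s Is.
  rewrite !dot_lin (dotC (N' s) (T s)) dotTT// dotTN'// => h.
  by apply/eqP; rewrite -subr_eq0 -[X in _ == X](subrr ((c * k s) ^+ 2)) -{1}h;
    apply/eqP; ring.
(* [D + T] is, up to sign, [c] times the third Frenet vector. As [c != 0], the vectors [T], [N],
   [D + T] form an orthogonal family filling [W]; the squared length [1 + c^2] of [D] is the
   constant [C] of the general equation. *)
pose D s := (k s)^-1 *: N' s.
have N'E s : I s -> N' s = k s *: D s.
  by move=> Is; rewrite scalerA divff ?k0// scale1r.
have DW s : I s -> (D s <= W)%MS by move=> Is; rewrite scalemx_sub ?N'W.
pose D' := derive1 D.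
have dD s : I s -> is_derive s 1 D (D' s).
  move=> Is; apply: is_derive1P.
  by have := is_derive_scale (is_deriveVf (k0 s Is) (dk s Is))
    (is_derive1P (N'd s Is)).
have D'W s : I s -> (D' s <= W)%MS.
  exact: is_derive_submx dD DW s.
have dotDN s : I s -> dot (D s) (N s) = 0.
  by move=> Is; rewrite dotZl dotN'N// mulr0.
have dotDT s : I s -> dot (D s) (T s) = -1.
  by move=> Is; rewrite dotZl dotC dotTN'// mulrN mulVf ?k0.
have dotDD s : I s -> dot (D s) (D s) = 1 + c ^+ 2.
  by move=> Is; have := k0 s Is; rewrite dotZl dotZr dotN'N'// => ?; field.
clearbody D D'.
have dotDT2 s : I s -> dot (D s + T s) (D s + T s) = c ^+ 2.
  move=> Is; rewrite !dot_lin (dotC (T s) (D s)) dotDD// dotDT// dotTT//.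
  by ring.
(* [D'] is orthogonal to [D] and [T], because [dot D D] and [dot D T] are constant and [D] is
   orthogonal to [T' = k N]. Its component along [N] is [- dot D N' = - k (1 + c^2)]. *)
have D'E s : I s -> D' s = - ((1 + c ^+ 2) * k s) *: N s.
  move=> Is; apply/eqP; rewrite scaleNr -addr_eq0; apply/eqP.
  apply: (orthogonal_complement_eq0 (W := W)
            (s := [:: T s; N s; D s + T s])) => //=.
  - by rewrite rW.
  - rewrite T_neq0// TW// NW// addmx_sub ?DW ?TW// !andbT/= -!dot_eq0.
    by rewrite dotNN// oner_neq0/= dotDT2// expf_neq0.
  - rewrite !dot_lin dotTN// (dotC (N s) (T s)) dotTN// (dotC (N s) (D s)).
    by rewrite dotDN// (dotC (T s) (D s)) dotDT// dotTT// addNr addr0 eqxx.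
  - by rewrite addmx_sub ?D'W ?scalemx_sub ?NW.
  - have := dot_cst_derive Is dotDT (dD s Is) (dT Is).
    have := dot_cst_derive Is dotDN (dD s Is) (dN s Is).
    have := dot_cst_derive Is dotDD (dD s Is) (dD s Is).
    rewrite (dotC (D s) (D' s)) -mulr2n => /eqP.
    rewrite mulrn_eq0/= => /eqP DD.
    rewrite N'E// T'E// !dotZr dotDD// dotDN// mulr0 addr0 => DN DT.
    rewrite !dot_lin (dotC (N s) (T s)) (dotC (N s) (D s)).
    rewrite dotTN// dotNN// dotDN// DD DT !mulr0 !addr0 mulr1 !eqxx/= andbT.
    by rewrite mulrC DN eqxx.
have dND s : I s -> is_derive s 1 N (k s *: D s).
  by move=> Is; rewrite -N'E//; exact: dN.
have dDN s : I s -> is_derive s 1 D (- ((1 + c ^+ 2) * k s) *: N s).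
  by move=> Is; rewrite -D'E//; exact: dD.
have [q [v qv]] := curvature_ode_image_line I0 Iitv k0 dND dDN dk dk1 ode.
by exists q, v => s Is; rewrite T'E//; exact: qv.
Qed.

End UnitTangentField.

(** * From [T'] on a line to [T] on a circle *)

Lemma continuous_neq0_gt0 (R : realType) (I : set R) (f : R -> R) :
  is_interval I -> (forall s, I s -> derivable f s 1) ->
  (forall s, I s -> f s != 0) ->
  forall s t, I s -> I t -> 0 < f s -> 0 < f t.
Proof.
move=> Iitv df f0 s t Is It fs0; rewrite ltNge; apply/negP => ft0.
have cont x y : I x -> I y -> {within `[x, y], continuous f}.
  move=> Ix Iy; apply: derivable_within_continuous => z.
  by rewrite in_itv/= => /(Iitv _ _ Ix Iy); exact: df.
have [st|/ltW ts] := leP s t.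
  have [|c] := IVT st (cont _ _ Is It) (v := 0).
    by rewrite ge_min le_max ft0 (ltW fs0) orbT.
  by rewrite in_itv/= => /(Iitv _ _ Is It) /f0/eqP.
have [|c] := IVT ts (cont _ _ It Is) (v := 0).
  by rewrite ge_min le_max ft0 (ltW fs0) orbT.
by rewrite in_itv/= => /(Iitv _ _ It Is) /f0/eqP.
Qed.

(* The unit tangent runs on the circle of radius [r] and centre [w], in
   coordinates [(u, f)], and its component along [e] has constant speed [a]. *)
Record circular_tangent (R : realType) (m : nat) (I : set R)
    (T T' : R -> 'rV[R]_m) (w e v : 'rV[R]_m) (a r : R) (u f : R -> R) : Prop :=
{
  ct_a : 0 < a;
  ct_r : 0 < r;
  ct_ee : dot e e = 1;
  ct_vv : dot v v = 1;
  ct_ev : dot e v = 0;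
  ct_we : dot w e = 0;
  ct_wv : dot w v = 0;
  ct_ww : dot w w = 1 - r ^+ 2;
  ct_f : forall s, I s -> 0 < f s;
  ct_uf : forall s, I s -> u s ^+ 2 + f s ^+ 2 = r ^+ 2;
  ct_du : forall s, I s -> is_derive s 1 u a;
  ct_df : forall s, I s -> is_derive s 1 f (- (a * u s) / f s);
  ct_T : forall s, I s -> T s = w + u s *: e + f s *: v;
  ct_T' : forall s, I s -> T' s = a *: e - (a * u s / f s) *: v
}.

Section UnitTangentOfLine.
Variables (R : realType) (m : nat) (I : set R).
Hypothesis hI : open_interval I.

Let I0 : I !=set0. Proof. by case: hI. Qed.
Let oI : open I. Proof. by case: hI. Qed.
Let Iitv : is_interval I. Proof. by case: hI. Qed.

Variables T T' : R -> 'rV[R]_m.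
Hypothesis dT : forall s, I s -> is_derive s 1 T (T' s).
Hypothesis TT : forall s, I s -> dot (T s) (T s) = 1.

Let TT' s : I s -> dot (T s) (T' s) = 0.
Proof. exact: dotTT' hI _ _ dT TT s. Qed.

(** This is the case of a line through the origin. For [y = dot T v], orthogonality of [T] and [T']
    gives [y' y = 0], so [y^2] is constant. If [y] is nonzero at [s], then [y' = 0] there at once;
    if [y] vanishes at [s], it vanishes on [I]. *)
Lemma derive_colinear_eq0 (v : 'rV[R]_m) :
  (forall s, I s -> T' s = dot (T' s) v *: v) -> forall s, I s -> T' s = 0.
Proof.
move=> T'v s Is; rewrite T'v//.
have Tv t : I t -> dot (T' t) v * dot (T t) v = 0.
  by move=> It; have := TT' It; rewrite {1}T'v// dotZr.
have [Tvs|Tvs] := eqVneq (dot (T s) v) 0; last first.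
  have /eqP := Tv s Is; rewrite mulf_eq0 (negPf Tvs) orbF => /eqP ->.
  by rewrite scale0r.
have Tv0 t : I t -> dot (T t) v = 0.
  move=> It; apply/eqP; rewrite -sqrf_eq0; apply/eqP.
  have <- : dot (T s) v ^+ 2 = 0 by rewrite Tvs expr0n.
  apply: (derive0_cst_on (k := fun t => dot (T t) v ^+ 2) Iitv) => // x Ix.
  apply: (is_derive_eq (is_deriveXf 2 (is_derive_dotl v (dT Ix)))).
  by rewrite -mulrA (mulrC (_ ^+ _)) expr1 Tv// mulr0.
have h : is_derive s 1 (fun t => dot (T t) v) 0.
  by apply: (is_derive_on (f := cst 0) oI Is) => t It; rewrite Tv0.
by rewrite -(is_derive1E (is_derive_dotl v (dT Is))) (is_derive1E h) scale0r.
Qed.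

Lemma derive_in_line (q v : 'rV[R]_m) :
  (forall s, I s -> exists t, T' s = q + t *: v) ->
  (forall s, I s -> T' s = 0) \/
  exists w e v a r u f, circular_tangent I T T' w e v a r u f.
Proof.
move=> qv; have [s0 Is0] := I0.
have [v0|v0] := eqVneq v 0.
  left; have T'q s : I s -> T' s = q.
    by move=> /qv[t ->]; rewrite v0 scaler0 addr0.
  move=> s Is; rewrite T'q//; apply/eqP; rewrite -dot_eq0; apply/eqP.
  have h : is_derive s 1 (fun t => dot (T t) q) 0.
    apply: (is_derive_on (f := cst 0) oI Is) => t It.
    by rewrite -(T'q t It) TT'.
  have h' := is_derive_dotl q (dT Is).
  by rewrite -{1}(T'q s Is) -(is_derive1E h') (is_derive1E h).
pose v1 := (enorm v)^-1 *: v.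
have nv0 : enorm v != 0 by rewrite enorm_eq0.
have v1v1 : dot v1 v1 = 1.
  by rewrite dotZl dotZr -enorm_sqr; field.
(* [q1] is the foot of the perpendicular from the origin to the line. Its length is the constant
   speed [a], its direction is [e]. *)
pose q1 := q - dot q v1 *: v1.
have q1v1 : dot q1 v1 = 0 by rewrite dotDl dotNl dotZl v1v1 mulr1 subrr.
have T'q1 s : I s -> T' s = q1 + dot (T' s) v1 *: v1.
  move=> /qv[t ->]; have -> : t *: v = (t * enorm v) *: v1.
    by rewrite scalerA mulfK.
  rewrite dotDl dotZl v1v1 mulr1 /q1; apply/rowP => i; rewrite !mxE; ring.
have [q10|q10] := eqVneq q1 0.
  by left; apply: (@derive_colinear_eq0 v1) => s /T'q1; rewrite q10 add0r.
right; pose a := enorm q1; pose e := a^-1 *: q1.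
have a0 : a != 0 by rewrite enorm_eq0.
have a_gt0 : 0 < a by rewrite lt_def a0 sqrtr_ge0.
have ee : dot e e = 1 by rewrite dotZl dotZr -enorm_sqr -/a; field.
have ev : dot e v1 = 0 by rewrite dotZl q1v1 mulr0.
have T'E s : I s -> T' s = a *: e + dot (T' s) v1 *: v1.
  have ae : a *: e = q1 by rewrite /e scalerA divff// scale1r.
  by move=> Is; rewrite ae -T'q1.
clearbody v1 a e.
pose u s := dot (T s) e; pose f s := dot (T s) v1; pose f1 s := dot (T' s) v1.
have du s : I s -> is_derive s 1 u a.
  move=> Is; apply: (is_derive_eq (is_derive_dotl e (dT Is))).
  by rewrite T'E// dotDl !dotZl ee (dotC v1) ev mulr0 addr0 mulr1.
have df s : I s -> is_derive s 1 f (f1 s).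
  by move=> Is; exact: is_derive_dotl (dT Is).
have T'f s : I s -> T' s = a *: e + f1 s *: v1 by exact: T'E.
(* The part of [T] orthogonal to [e] and [v1] is constant, since [T'] has components only along
   these two vectors. *)
pose w s := T s - u s *: e - f s *: v1.
have wE s : I s -> w s = w s0.
  move=> Is; apply: (derive0_cst_on_mx Iitv) => // x Ix.
  have ce := is_derive_cst e x 1; have cv := is_derive_cst v1 x 1.
  have h := is_deriveBf (dT Ix) (is_derive_scale (du x Ix) ce).
  apply: (is_derive_eq (is_deriveBf h (is_derive_scale (df x Ix) cv))).
  by rewrite T'f// !scaler0 !addr0 [X in X - _]addrAC subrr add0r subrr.
have we : dot (w s0) e = 0.
  rewrite !dotDl !dotNl !dotZl ee (dotC v1) ev mulr0 oppr0 addr0 mulr1.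
  by rewrite subrr.
have wv : dot (w s0) v1 = 0.
  by rewrite !dotDl !dotNl !dotZl ev v1v1 mulr0 oppr0 addr0 mulr1 subrr.
have TE s : I s -> T s = w s0 + u s *: e + f s *: v1.
  by move=> /wE <-; rewrite /w addrAC !subrK.
clearbody w.
have ufE s : I s -> u s ^+ 2 + f s ^+ 2 = 1 - dot (w s0) (w s0).
  move=> Is; rewrite -(TT Is) (TE s Is) !dot_lin.
  rewrite (dotC e (w s0)) (dotC v1 (w s0)).
  rewrite (dotC v1 e) ee ev v1v1 we wv; ring.
have uff1 s : I s -> a * u s + f s * f1 s = 0.
  move=> Is; have := TT' Is.
  rewrite {1}T'f// dotDr !dotZr -/(u s) -/(f s) => <-.
  by rewrite (mulrC (f s)).
(* At a zero of [f], the relation [a u + f f1 = 0] forces [u = 0], so the constant [u^2 + f^2] is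
   zero. Then [u] vanishes on [I], against [u' = a != 0]. *)
have f0 s : I s -> f s != 0.
  move=> Is; apply/negP => /eqP fs0.
  have /eqP := uff1 s Is; rewrite fs0 mul0r addr0 mulf_eq0 (negPf a0)/=.
  move=> /eqP us0; have := ufE s Is; rewrite fs0 us0 expr0n addr0 => r0.
  have u0 t : I t -> 0 = u t.
    move=> It; apply/esym/eqP; rewrite -sqrf_eq0 eq_le sqr_ge0 andbT.
    by rewrite [leRHS]r0 -(ufE t It) lerDl sqr_ge0.
  have h := is_derive_on oI Is u0 (is_derive_cst 0 s 1).
  by move/eqP: a0; apply; rewrite -(is_derive1E (du s Is)) (is_derive1E h).
have r0 : 0 < u s0 ^+ 2 + f s0 ^+ 2.
  by rewrite ltr_wpDl ?sqr_ge0// lt_def sqr_ge0 sqrf_eq0 f0.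
have f1E s : I s -> f1 s = - (a * u s) / f s.
  move=> Is; have := uff1 s Is => /eqP; rewrite addr_eq0 => /eqP ->.
  by have := f0 s Is; rewrite opprK => ?; field.
have fdrv s : I s -> derivable f s 1 by move=> /df.
(* [f] has constant sign on [I]; replacing [v1] by [g *: v1] makes it positive, so that [a r / f] is
   a norm and not only a norm up to sign. *)
pose g := Num.sg (f s0).
have g2 : g ^+ 2 = 1 by rewrite sqr_sg f0.
have g0 : g != 0 by rewrite sgr_eq0 f0.
have gV : g^-1 = g by apply: (mulfI g0); rewrite divff// -expr2.
have gf_gt0 s : I s -> 0 < g * f s.
  move=> Is.
  apply: (continuous_neq0_gt0 (f := fun t => g * f t) Iitv _ _ Is0 Is).
  - move=> t It.
    by have := is_deriveMf (is_derive_cst g t 1) (df t It).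
  - by move=> t It; rewrite mulf_neq0 ?f0.
  - by rewrite -normrEsg normr_gt0 f0.
exists (w s0), e, (g *: v1), a, (Num.sqrt (u s0 ^+ 2 + f s0 ^+ 2)), u,
  (fun s => g * f s); split => //.
- by rewrite sqrtr_gt0.
- by rewrite dotZl dotZr mulrA -expr2 g2 mul1r.
- by rewrite dotZr ev mulr0.
- by rewrite dotZr wv mulr0.
- by rewrite sqr_sqrtr ?ltW// ufE// subKr.
- by move=> s Is; rewrite sqr_sqrtr ?ltW// exprMn g2 mul1r !ufE.
- move=> s Is.
  apply: (is_derive_eq (is_deriveMf (is_derive_cst g s 1) (df s Is))).
  by rewrite mul0r add0r f1E//= invfM gV; ring.
- by move=> s Is; rewrite {1}TE// scalerA mulrAC -expr2 g2 mul1r.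
- move=> s Is; rewrite T'f// scalerA -[X in _ = _ + X]scaleNr.
  congr (_ + _ *: _); rewrite f1E//.
  by rewrite /= invfM gV -[LHS]mulr1 -g2; ring.
Qed.

End UnitTangentOfLine.

(** * Curvatures of a curve whose unit tangent runs on a circle *)

Section CircularTangent.
Variables (R : realType) (m : nat) (I : set R) (T T' : R -> 'rV[R]_m).
Variables (w e v : 'rV[R]_m) (a r : R) (u f : R -> R).
Hypothesis hI : open_interval I.
Hypothesis ct : circular_tangent I T T' w e v a r u f.

Let oI : open I. Proof. by case: hI. Qed.
Let f0 s : I s -> f s != 0.
Proof. by move=> /(ct_f ct); exact: lt0r_neq0. Qed.
Let a0 : a != 0. Proof. exact: lt0r_neq0 (ct_a ct). Qed.
Let r0 : r != 0. Proof. exact: lt0r_neq0 (ct_r ct). Qed.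

(** For orthonormal [x], [y] this skew matrix, acting on rows from the right, is the quarter turn
    [x |-> y], [y |-> - x] of their plane and kills the orthogonal complement. *)
Definition rotation (x y : 'rV[R]_m) : 'M[R]_m := x^T *m y - y^T *m x.

Lemma dot_rotation x y (z z' : 'rV[R]_m) :
  dot (z *m rotation x y) z' = dot z x * dot y z' - dot z y * dot x z'.
Proof.
have H (p q : 'rV[R]_m) : z *m (p^T *m q) = dot z p *: q.
  by rewrite mulmxA [z *m _]mx11_scalar mul_scalar_mx -dotE.
by rewrite mulmxBr !H !dot_lin.
Qed.

(** In coordinates with respect to [e], [v] this is Lagrange's identity for a determinant of order
    two. *)
Lemma area_form_rotation : area_form (e + v)%MS (rotation e v).
Proof.
split; first by rewrite /rotation linearB/= !trmx_mul !trmxK opprB.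
move=> _ _ /sub_addsmxP[[x1 x2]/= ->] /sub_addsmxP[[y1 y2]/= ->].
rewrite [x1]mx11_scalar [x2]mx11_scalar [y1]mx11_scalar [y2]mx11_scalar.
rewrite !mul_scalar_mx dot_rotation !dot_lin (dotC v e).
by rewrite (ct_ee ct) (ct_vv ct) (ct_ev ct); ring.
Qed.

(** With [w = 0] the circle has radius [1], and the determinant of [T] and [T'] is
    [- a (u^2 + f^2) / f]. *)
Lemma circular_plane_curvature : w = 0 ->
  forall s, I s -> dot (T s *m rotation e v) (T' s) = - a / f s.
Proof.
move=> w0 s Is; have r1 : r ^+ 2 = 1.
  by have := ct_ww ct; rewrite w0 dot0l => /esym/eqP; rewrite subr_eq0 => /eqP.
rewrite dot_rotation (ct_T ct Is) (ct_T' ct Is) w0 !dot_lin (dotC v e).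
rewrite (ct_ee ct) (ct_vv ct) (ct_ev ct).
have fs0 := f0 Is; have ufs := ct_uf ct Is; rewrite r1 in ufs.
transitivity (- (a * (u s ^+ 2 + f s ^+ 2)) / f s); first by field.
by rewrite ufs mulr1.
Qed.

Lemma circular_kappa1 s : I s -> enorm (T' s) = a * r / f s.
Proof.
move=> Is; rewrite /enorm.
have -> : dot (T' s) (T' s) = (a * r / f s) ^+ 2.
  rewrite (ct_T' ct Is) !dot_lin (dotC v e) (ct_ee ct) (ct_vv ct) (ct_ev ct).
  rewrite !exprMn -(ct_uf ct Is); have := f0 Is => fs0; field.
  exact: fs0.
rewrite sqrtr_sqr ger0_norm// ltW// divr_gt0 ?(ct_f ct)//.
by rewrite mulr_gt0 ?(ct_a ct) ?(ct_r ct).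
Qed.

(** Since [T' = (a / f) (f e - u v)], the normal is [(f e - u v) / r], the unit tangent of the
    circle. *)
Lemma circular_normal (N : R -> 'rV[R]_m) :
  (forall s, I s -> N s = (enorm (T' s))^-1 *: T' s) -> forall s, I s ->
  is_derive s 1 N (- (a / (r * f s)) *: (u s *: e + f s *: v)).
Proof.
move=> NE s Is.
have ce := is_derive_cst e s 1; have cv := is_derive_cst v s 1.
have h1 := is_derive_scale (ct_df ct Is) ce.
have h2 := is_derive_scale (ct_du ct Is) cv.
have h := is_derive_scale (is_derive_cst r^-1 s 1) (is_deriveBf h1 h2).
apply: is_derive_eq.
  apply: (is_derive_on oI Is _ h) => t It; rewrite NE// circular_kappa1//.
  rewrite (ct_T' ct It); have ft0 := f0 It.
  by apply/rowP => i; rewrite !mxE /cst; field; rewrite r0 a0 ft0.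
have fs0 := f0 Is.
by apply/rowP => i; rewrite !mxE /cst; field; rewrite r0 fs0.
Qed.

Lemma circular_kappa2 s : I s ->
  enorm (- (a / (r * f s)) *: (u s *: e + f s *: v) + enorm (T' s) *: T s) =
  enorm w / r * enorm (T' s).
Proof.
move=> Is; have fs0 := f0 Is; rewrite {1}/enorm circular_kappa1//.
set x := _ + _.
have -> : dot x x = (enorm w / r * (a * r / f s)) ^+ 2.
  rewrite /x (ct_T ct Is) !dot_lin (dotC v e) (dotC e w) (dotC v w).
  rewrite (ct_ee ct) (ct_vv ct) (ct_ev ct) (ct_we ct) (ct_wv ct).
  rewrite !exprMn enorm_sqr (ct_ww ct).
  have u2 : u s * u s = r ^+ 2 - f s ^+ 2.
    by rewrite -(ct_uf ct Is) addrK expr2.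
  (* The vector is [a / f] times [r w + (r - r^-1) (u e + f v)], an orthogonal sum; the two terms
     are its squared lengths. *)
  transitivity ((a / f s) ^+ 2 * (r ^+ 2 * (1 - r ^+ 2)
    + (u s * u s + f s ^+ 2) * (r - r^-1) ^+ 2)).
    by field; rewrite r0 fs0.
  by rewrite u2; field; rewrite r0 fs0.
rewrite sqrtr_sqr ger0_norm//.
rewrite mulr_ge0// divr_ge0 ?sqrtr_ge0 ?(ltW (ct_r ct))// ?(ltW (ct_f ct Is))//.
by rewrite mulr_ge0 ?(ltW (ct_r ct)) ?(ltW (ct_a ct)).
Qed.

Lemma circular_submx s : I s -> (T s <= w + e + v)%MS.
Proof.
move=> Is; rewrite (ct_T ct Is) !addmx_sub_adds// scalemx_sub//.
Qed.

Lemma circular_rank : w != 0 -> \rank (w + e + v)%MS = 3%N.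
Proof.
move=> w0; apply/eqP; rewrite eqn_leq; apply/andP; split.
  apply: (leq_trans (mxrank_adds_leqif _ _)); rewrite -[3%N]/(2 + 1)%N.
  apply: leq_add (rank_leq_row _).
  apply: (leq_trans (mxrank_adds_leqif _ _)); rewrite -[2%N]/(1 + 1)%N.
  exact: leq_add (rank_leq_row _) (rank_leq_row _).
apply: (@orthogonal_leq_rank _ _ _ [:: w; e; v]) => /=.
  have wW : (w <= w + e + v)%MS.
    exact: submx_trans (addsmxSl w e) (addsmxSl _ v).
  have eW : (e <= w + e + v)%MS.
    exact: submx_trans (addsmxSr w e) (addsmxSl _ v).
  by rewrite w0 wW eW addsmxSr -!dot_eq0 (ct_ee ct) (ct_vv ct) oner_neq0.
by rewrite (ct_we ct) (ct_wv ct) (ct_ev ct) eqxx.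
Qed.

(** [k^-2 = (r^2 - u^2) / b^2] is quadratic in [s] with second derivative [- 2 a^2 / b^2 = - 2 C].
    Both cases use this: [b = - a], [C = 1] in the plane, and [b = a r], [C = r^-2] for the
    helix. *)
Lemma circular_curvature_ode (k : R -> R) (b C : R) : C * b ^+ 2 = a ^+ 2 ->
  (forall s, I s -> k s = b / f s) -> forall s, I s ->
  k s * derive1n 2 k s - C * k s ^+ 4 = 3 * derive1 k s ^+ 2.
Proof.
move=> Cb kE s Is.
have [||-> ->] := @derive1n2_on _ _ hI k (fun t => b / f t)
  (fun t => b * a * u t * (f t)^-1 ^+ 3)
  (fun t => b * a ^+ 2 * (f t)^-1 ^+ 3
     + 3 * b * a ^+ 2 * u t ^+ 2 * (f t)^-1 ^+ 5) kE _ _ s Is.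
- move=> t It; have ? := f0 It.
  have h := is_deriveVf (f0 It) (ct_df ct It).
  apply: (is_derive_eq (is_deriveMf (is_derive_cst b t 1) h)).
  by rewrite /cst/=; field.
- move=> t It; have ? := f0 It.
  have h := is_deriveMf (is_derive_cst (b * a) t 1) (ct_du ct It).
  have h' := is_deriveXf 3 (is_deriveVf (f0 It) (ct_df ct It)).
  by apply: (is_derive_eq (is_deriveMf h h')); rewrite /cst/=; field.
- have ? := f0 Is; rewrite kE//; apply/eqP; rewrite -subr_eq0.
  rewrite [X in X == _](_ : _ = b ^+ 2 / f s ^+ 4 * (a ^+ 2 - C * b ^+ 2)).
    by rewrite Cb subrr mulr0.
  by field.
Qed.

End CircularTangent.

(** * Back to the curve: its flats, its Frenet data and its Laplace image *)

Section ArclengthCurve.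
Variables (R : realType) (m : nat) (I : set R).
Hypothesis hI : open_interval I.

Let I0 : I !=set0. Proof. by case: hI. Qed.
Let Iitv : is_interval I. Proof. by case: hI. Qed.

Lemma submx_flat (W : 'M[R]_m) (F F' : R -> 'rV[R]_m) s0 : I s0 ->
  (forall s, I s -> is_derive s 1 F (F' s)) ->
  (forall s, I s -> (F' s <= W)%MS) -> F @` I `<=` flat (F s0) W.
Proof.
move=> Is0 dF F'W _ [s Is <-]; rewrite /flat/= submxE mulmxBl subr_eq0.
apply/eqP.
apply: (derive0_cst_on_mx (F := fun s => F s *m cokermx W) Iitv) => //.
move=> t It; apply: (is_derive_eq (is_derive_mulmx (cokermx W) (dF t It))).
by apply/eqP; rewrite -submxE F'W.
Qed.

Lemma enorm_twice_derivable (F F1 F2 : R -> 'rV[R]_m) :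
  (forall s, I s -> is_derive s 1 F (F1 s)) ->
  (forall s, I s -> is_derive s 1 F1 (F2 s)) ->
  (forall s, I s -> enorm (F s) != 0) ->
  exists k1 k2 : R -> R, forall s, I s ->
    is_derive s 1 (fun t => enorm (F t)) (k1 s) /\ is_derive s 1 k1 (k2 s).
Proof.
move=> dF dF1 F0; pose k t := enorm (F t).
pose k1 s := (dot (F1 s) (F s) + dot (F s) (F1 s)) * (2 * k s)^-1.
have dk s : I s -> is_derive s 1 k (k1 s).
  move=> Is.
  apply: is_derive_sqrtf; last exact: is_derive_dot (dF s Is) (dF s Is).
  by rewrite dot_gt0// -enorm_eq0 F0.
exists k1, (derive1 k1) => s Is; split; first exact: dk.
apply: is_derive1P.
have h1 := is_deriveDf (is_derive_dot (dF1 s Is) (dF s Is))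
             (is_derive_dot (dF s Is) (dF1 s Is)).
have h2 := is_deriveMf (is_derive_cst (2 : R) s 1) (dk s Is).
have k20 : 2 * k s != 0 by rewrite mulf_neq0 ?F0// pnatr_eq0.
exact: (@ex_derive _ _ _ _ _ _ _ (is_deriveMf h1
  (is_deriveVf (k := fun t => 2 * k t) k20 h2))).
Qed.

Lemma normalized_twice_derivable (k k1 k2 : R -> R) (F F1 F2 : R -> 'rV[R]_m) :
  (forall s, I s -> is_derive s 1 F (F1 s)) ->
  (forall s, I s -> is_derive s 1 F1 (F2 s)) ->
  (forall s, I s -> is_derive s 1 k (k1 s)) ->
  (forall s, I s -> is_derive s 1 k1 (k2 s)) ->
  (forall s, I s -> k s != 0) ->
  exists N1 N2 : R -> 'rV[R]_m, forall s, I s ->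
    is_derive s 1 (fun t => (k t)^-1 *: F t) (N1 s) /\ is_derive s 1 N1 (N2 s).
Proof.
move=> dF dF1 dk dk1 k0.
pose N1 s := (- k1 s * (k s ^+ 2)^-1) *: F s + (k s)^-1 *: F1 s.
exists N1, (derive1 N1) => s Is; have dks := is_deriveVf (k0 s Is) (dk s Is).
split; first exact: is_derive_scale dks (dF s Is).
apply: is_derive1P.
have k20 : k s ^+ 2 != 0 by rewrite expf_neq0 ?k0.
have h1 := is_deriveMf (is_deriveNf (dk1 s Is))
  (is_deriveVf (k := fun t => k t ^+ 2) k20 (is_deriveXf 2 (dk s Is))).
have h2 := is_deriveDf (is_derive_scale h1 (dF s Is))
  (is_derive_scale dks (dF1 s Is)).
exact: (@ex_derive _ _ _ _ _ _ _ h2).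
Qed.

Variable beta : R -> 'rV[R]_m.
Variables T T' T'' : R -> 'rV[R]_m.
Hypothesis TE : derive1 beta = T.
Hypothesis T'E : derive1n 2 beta = T'.
Hypothesis dbeta : forall s, I s -> is_derive s 1 beta (T s).
Hypothesis dT : forall s, I s -> is_derive s 1 T (T' s).
Hypothesis dT' : forall s, I s -> is_derive s 1 T' (T'' s).
Hypothesis dT'' : forall s, I s -> derivable T'' s 1.
Hypothesis dotTT : forall s, I s -> dot (T s) (T s) = 1.

Lemma kappa1E s : kappa1 beta s = enorm (T' s).
Proof. by rewrite -T'E. Qed.

Lemma frenet2E s : frenet2 beta s = (enorm (T' s))^-1 *: T' s.
Proof. by rewrite -T'E. Qed.

Lemma kappa2E (s : R) dN : is_derive s 1 (frenet2 beta) dN ->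
  kappa2 beta s = enorm (dN + enorm (T' s) *: T s).
Proof. by move=> h; rewrite /kappa2 kappa1E (is_derive1E h) /frenet1 TE. Qed.

Lemma laplace_image_lineP :
  (exists l, is_line l /\ laplace_image I beta `<=` l) <->
  exists q v : 'rV[R]_m, forall s, I s -> exists t, T' s = q + t *: v.
Proof.
have LE s : laplace_map beta s = - T' s by rewrite /laplace_map T'E.
split=> [[l [[q [v [_ ->]]] lI]]|[q [v qv]]].
  exists (- q), (- v) => s Is.
  have [|t _ qtv] := lI (laplace_map beta s); first by exists s.
  by exists t; apply: oppr_inj; rewrite -LE -qtv opprD scalerN !opprK.
have [s0 Is0] := I0.
have [v0|v0] := eqVneq v 0.
  (* The image is a single point; a line through it needs a nonzero direction, and the unit vector
     [T s0] supplies one. *)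
  exists [set - q + t *: T s0 | t in [set: R]]; split.
    by exists (- q), (T s0); split=> //; exact: T_neq0 dotTT _ Is0.
  move=> _ [s Is <-]; exists 0 => //; have [t] := qv s Is.
  by rewrite LE v0 scaler0 scale0r !addr0 => ->.
exists [set - q + t *: v | t in [set: R]]; split; first by exists (- q), v.
move=> _ [s Is <-]; have [t tE] := qv s Is; exists (- t) => //.
by rewrite LE tE opprD scaleNr.
Qed.

Lemma planar_image_line (kappa : R -> R) :
  planar_with_curvature I beta kappa ->
  (forall s, I s ->
    kappa s * derive1n 2 kappa s - kappa s ^+ 4 = 3 * derive1 kappa s ^+ 2) ->
  exists q v : 'rV[R]_m, forall s, I s -> exists t, T' s = q + t *: v.
Proof.
move=> [p [W [J [rW bW [_ areaJ] kE]]]] ode.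
rewrite /plane_curvature TE T'E in kE.
have TW := is_derive_flat hI dbeta bW.
have T'W := is_derive_submx hI dT TW.
(* [kappa] is known only on [I]; this bilinear expression agrees with it there and has visible
   derivatives. *)
pose k s := dot (T s *m J) (T' s).
pose k1 s := dot (T' s *m J) (T' s) + dot (T s *m J) (T'' s).
have dk s : I s -> is_derive s 1 k (k1 s).
  move=> Is; apply: is_derive_dot; last exact: dT'.
  by apply: is_derive_mulmx; exact: dT.
have dk1 s : I s -> is_derive s 1 k1 (derive1 k1 s).
  move=> Is; apply: is_derive1P.
  have h1 := is_derive_dot (is_derive_mulmx J (dT' Is)) (dT' Is).
  have h2 := is_derive_dot (is_derive_mulmx J (dT Is)) (is_derive1P (dT'' Is)).
  exact: (@ex_derive _ _ _ _ _ _ _ (is_deriveDf h1 h2)).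
apply: (planar_unit_tangent hI dT dT' dotTT rW TW _ dk dk1) => s Is.
  (* For a unit vector [T] orthogonal to [T'], the squared area is [dot T' T']. *)
  rewrite /k areaJ ?TW ?T'W// dotTT//.
  by rewrite (dotTT' hI dT dotTT Is) mul1r expr0n subr0.
have [<- <-] := derive1n2_on hI kE dk dk1 Is.
by rewrite -[k s]kE// ode.
Qed.

Lemma helix_image_line (c : R) : c != 0 -> helix_in_3space I beta ->
  (forall s, I s -> kappa2 beta s = c * kappa1 beta s /\
    kappa1 beta s * derive1n 2 (kappa1 beta) s
      - (1 + c ^+ 2) * kappa1 beta s ^+ 4 = 3 * derive1 (kappa1 beta) s ^+ 2) ->
  exists q v : 'rV[R]_m, forall s, I s -> exists t, T' s = q + t *: v.
Proof.
move=> c0 [[p [W [rW bW]]] k0 _] hk.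
have TW := is_derive_flat hI dbeta bW.
pose k s := enorm (T' s).
have {}k0 s : I s -> k s != 0 by rewrite /k -kappa1E; exact: k0.
have dT''1 s : I s -> is_derive s 1 T'' (derive1 T'' s).
  by move=> Is; apply: is_derive1P; exact: dT''.
have [k1 [k2 dk]] := enorm_twice_derivable dT' dT''1 k0.
have {}[dk1 dk2] : (forall s, I s -> is_derive s 1 k (k1 s)) /\
    (forall s, I s -> is_derive s 1 k1 (k2 s)).
  by split=> s /dk[].
have [N1 [N2 dN]] := normalized_twice_derivable dT' dT''1 dk1 dk2 k0.
apply: (helix_unit_tangent (k := k) (N := fun s => (k s)^-1 *: T' s) (N' := N1)
  hI dT dotTT c0 rW TW k0 _ dk1 dk2) => s Is.
- by rewrite enorm_sqr.
- by rewrite scalerA divff ?k0// scale1r.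
- by have [] := dN s Is.
- by have [_ h] := dN s Is; exact: (@ex_derive _ _ _ _ _ _ _ h).
- have hN : is_derive s 1 (frenet2 beta) (N1 s).
    by rewrite (funext frenet2E); have [] := dN s Is.
  by have [+ _] := hk s Is; rewrite (kappa2E hN) kappa1E -enorm_sqr => ->.
- have [_] := hk s Is.
  have [-> ->] := derive1n2_on hI (fun t _ => kappa1E t) dk1 dk2 Is.
  by rewrite kappa1E.
Qed.

Lemma line_planar_or_helix (q v : 'rV[R]_m) :
  (forall s, I s -> exists t, T' s = q + t *: v) ->
  (exists kappa : R -> R,
      planar_with_curvature I beta kappa /\
      forall s : R, I s ->
        kappa s * derive1n 2 kappa s - kappa s ^+ 4 = 3 * derive1 kappa s ^+ 2)
   \/
   (helix_in_3space I beta /\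
    exists c : R, c != 0 /\
      forall s : R, I s ->
        kappa2 beta s = c * kappa1 beta s /\
        kappa1 beta s * derive1n 2 (kappa1 beta) s
          - (1 + c ^+ 2) * kappa1 beta s ^+ 4
        = 3 * derive1 (kappa1 beta) s ^+ 2).
Proof.
move=> /(derive_in_line hI dT dotTT); have [s0 Is0] := I0.
case=> [T'0|[w [e [{}v [a [r [u [f ct]]]]]]]].
  left; exists (fun=> 0); split; last first.
    by move=> s _; rewrite derive1_cst mul0r !expr0n/= mulr0 subr0.
  (* A straight line: its own direction serves as [W], on which the zero matrix is an area form
     because parallel vectors span no area. *)
  exists (beta s0), <<T s0>>%MS, 0; split.
  - by rewrite mxrank_gen (leq_trans (rank_leq_row _)).
  - apply: (submx_flat Is0 dbeta) => s Is; rewrite genmxE.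
    have -> : T s = T s0; last exact: submx_refl.
    apply: (derive0_cst_on_mx Iitv) => // t It.
    by rewrite -(T'0 t It); exact: dT.
  - split; first by rewrite trmx0 oppr0.
    move=> x y; rewrite !genmxE => /sub_rVP[b ->] /sub_rVP[d ->].
    by rewrite mulmx0 !dot_lin; ring.
  - by move=> s Is; rewrite /plane_curvature mulmx0 dot0l.
have r_neq0 : r != 0 by exact: lt0r_neq0 (ct_r ct).
have [w0|w0] := eqVneq w 0.
  left; exists (plane_curvature (rotation e v) beta); split.
    exists (beta s0), (e + v)%MS, (rotation e v); split=> //.
    - apply: (leq_trans (mxrank_adds_leqif _ _)); rewrite -[2%N]/(1 + 1)%N.
      exact: leq_add (rank_leq_row _) (rank_leq_row _).
    - apply: (submx_flat Is0 dbeta) => s Is; rewrite (ct_T ct Is) w0 add0r.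
      by rewrite addmx_sub_adds// scalemx_sub.
    - exact: area_form_rotation ct.
  have kE s : I s -> plane_curvature (rotation e v) beta s = - a / f s.
    by rewrite /plane_curvature TE T'E; exact: (circular_plane_curvature ct w0).
  move=> s Is; have := circular_curvature_ode hI ct (C := 1) _ kE Is.
  by rewrite !mul1r sqrrN; exact.
right.
(* With [c = enorm w / r] this says [1 + c^2 = r^-2], hence [(1 + c^2) (a r)^2 = a^2], as the
   curvature equation requires. *)
have c2 : (enorm w / r) ^+ 2 = (1 - r ^+ 2) / r ^+ 2.
  by rewrite exprMn enorm_sqr (ct_ww ct) exprVn.
have c0 : enorm w / r != 0 by rewrite mulf_neq0 ?invr_eq0 ?enorm_eq0.
have k1E s : I s -> kappa1 beta s = a * r / f s.
  by move=> Is; rewrite kappa1E (circular_kappa1 ct Is).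
have k2E s : I s -> kappa2 beta s = enorm w / r * kappa1 beta s.
  move=> Is; have := circular_normal hI ct (fun t _ => frenet2E t) Is.
  by move=> /kappa2E ->; rewrite (circular_kappa2 ct Is) kappa1E.
have k1_neq0 s : I s -> kappa1 beta s != 0.
  move=> Is; rewrite k1E// !mulf_neq0 ?invr_eq0//.
    exact: lt0r_neq0 (ct_a ct).
  exact: lt0r_neq0 (ct_f ct Is).
split.
  split=> //.
    exists (beta s0), (w + e + v)%MS; split; first exact: circular_rank ct w0.
    by apply: (submx_flat Is0 dbeta) => s Is; exact: circular_submx ct _ Is.
  by exists (enorm w / r) => s Is; rewrite k2E// mulfK// k1_neq0.
exists (enorm w / r); split=> // s Is; split; first exact: k2E.
apply: (circular_curvature_ode hI ct _ k1E Is); rewrite c2.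
by field.
Qed.

End ArclengthCurve.

Unset Implicit Arguments.

Theorem proposition3p2 (R : realType) (m : nat) (I : set R)
    (beta : R -> 'rV[R]_m)
    (hI : open_interval I) (hbeta : arclength_curve I beta) :
  (exists l : set 'rV[R]_m, is_line l /\ laplace_image I beta `<=` l) <->
  ((exists kappa : R -> R,
      planar_with_curvature I beta kappa /\
      forall s : R, I s ->
        kappa s * derive1n 2 kappa s - kappa s ^+ 4 = 3 * derive1 kappa s ^+ 2)
   \/
   (helix_in_3space I beta /\
    exists c : R, c != 0 /\
      forall s : R, I s ->
        kappa2 beta s = c * kappa1 beta s /\
        kappa1 beta s * derive1n 2 (kappa1 beta) s
          - (1 + c ^+ 2) * kappa1 beta s ^+ 4
        = 3 * derive1 (kappa1 beta) s ^+ 2)).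
Proof.
have TE : derive1 beta = derive1 beta by [].
have T'E : derive1n 2 beta = derive1n 2 beta by [].
have dbeta s : I s -> is_derive s 1 beta (derive1 beta s).
  by move=> Is; apply: is_derive1P; exact: (hbeta.1 0%N s Is).
have dT s : I s -> is_derive s 1 (derive1 beta) (derive1n 2 beta s).
  by move=> Is; apply: is_derive1P; exact: (hbeta.1 1%N s Is).
have dT' s : I s -> is_derive s 1 (derive1n 2 beta) (derive1n 3 beta s).
  by move=> Is; apply: is_derive1P; exact: (hbeta.1 2%N s Is).
(* The fourth derivative of [beta] is what the second derivative of a curvature involves. *)
have dT'' s : I s -> derivable (derive1n 3 beta) s 1.
  exact: hbeta.1 3%N s.
have dotTT s : I s -> dot (derive1 beta s) (derive1 beta s) = 1.
  by move=> Is; rewrite -enorm_sqr hbeta.2// expr1n.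
apply: (iff_trans (laplace_image_lineP hI T'E dotTT)).
split=> [[q [v]]|].
  exact: (line_planar_or_helix hI TE T'E dbeta dT dotTT).
case=> [[kappa [planar ode]]|[helix [c [c0 ode]]]].
  exact: (planar_image_line hI TE T'E dbeta dT dT' dT'' dotTT planar ode).
exact: (helix_image_line hI TE T'E dbeta dT dT' dT'' dotTT c0 helix ode).
Qed.
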